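(* If $G\in\mathcal{G}$, then $gf(G)\geq Af(G)$.
   Context: $\mathcal{G}$ is the set of finite simple graphs $G$ with a perfect matching which do not contain two vertex-disjoint odd cycles $C,C'$ such that $G-V(C)-V(C')$ has a perfect matching (the empty graph counting as having one). For a perfect matching $M$ of $G$, $af(G,M)$ is the minimum size of a subset $S\subseteq E(G)\setminus M$ such that $G-S$ has a unique perfect matching, and $Af(G)=\max_M af(G,M)$. $gf(G)$ is the minimum size of an edge subset $S$ such that no two distinct perfect matchings $M_1,M_2$ of $G$ satisfy $M_1\cap S=M_2\cap S$. *)

(* Defs.v *)
From mathcomp Require Import all_boot.

Set Implicit Arguments.
Unset Strict Implicit.
Unset Printing Implicit Defensive.

(* A finite simple graph is a symmetric irreflexive e : rel T on T : finType;
   an edge is the 2-element set of its endpoints.  A vertex set V is carried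
   along so that vertex-deleted subgraphs (induced by V) live on the same T. *)
Section Graphs.
Variable T : finType.
Implicit Types (e : rel T) (V : {set T}) (S M : {set {set T}}).

Definition edges V e : {set {set T}} :=
  [set [set x; y] | x in V, y in V & e x y].

Definition del_edges e S : rel T :=
  [rel x y | e x y && ([set x; y] \notin S)].

(* Edges pairwise disjoint and covering exactly V; for V = set0, M = set0. *)
Definition perfect_matchings V e : {set {set {set T}}} :=
  [set M : {set {set T}} | (M \subset edges V e) && partition M V].

Definition has_perfect_matching V e : Prop :=
  exists M, M \in perfect_matchings V e.

(* The sequence c lists the vertices of the cycle once each, in cyclic order. *)
Definition is_odd_cycle e (c : seq T) : Prop :=
  [/\ ucycle e c, 2 < size c & odd (size c)].

Definition in_classG e : Prop :=
  has_perfect_matching setT e /\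
  ~ exists c c' : seq T,
      [/\ is_odd_cycle e c, is_odd_cycle e c', [disjoint c & c'] &
          has_perfect_matching (~: [set x in c] :\: [set x in c']) e].

Definition anti_forcing e M S : bool :=
  (S \subset edges setT e :\: M)
  && (#|perfect_matchings setT (del_edges e S)| == 1).

(* [arg min] ranges over a nonempty family when M is a perfect matching, since
   its default E \ M is then admissible (lemma anti_forcing_default). *)
Definition af e M : nat :=
  #|[arg min_(S < edges setT e :\: M | anti_forcing e M S) #|S|]|.

Definition Af e : nat := \max_(M in perfect_matchings setT e) af e M.

Definition global_forcing e S : bool :=
  (S \subset edges setT e)
  && [forall M1 in perfect_matchings setT e,
      forall M2 in perfect_matchings setT e,
        (M1 :&: S == M2 :&: S) ==> (M1 == M2)].

(* The default E is always admissible (lemma global_forcing_default). *)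
Definition gf e : nat :=
  #|[arg min_(S < edges setT e | global_forcing e S) #|S|]|.

Lemma global_forcing_default e : global_forcing e (edges setT e).
Proof.
rewrite /global_forcing subxx /=.
apply/forall_inP => M1; rewrite inE => /andP[/setIidPl M1E _].
apply/forall_inP => M2; rewrite inE => /andP[/setIidPl M2E _].
by rewrite M1E M2E; apply/implyP.
Qed.

Lemma edges_del e S : edges setT (del_edges e S) = edges setT e :\: S.
Proof.
apply/setP=> a; rewrite in_setD; apply/imset2P/andP.
  by case=> x y _; rewrite !inE /= => /andP[exy xyS] ->; split=> //;
    apply/imset2P; exists x y; rewrite ?inE.
case=> aS /imset2P[x y _]; rewrite !inE /= => exy axy; move: aS; rewrite axy.
by move=> xyS; exists x y; rewrite ?inE //=; apply/andP.
Qed.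

Lemma anti_forcing_default e M :
  M \in perfect_matchings setT e -> anti_forcing e M (edges setT e :\: M).
Proof.
rewrite inE => /andP[ME Mp]; rewrite /anti_forcing subxx /=.
apply/cards1P; exists M; apply/setP => N.
rewrite !inE edges_del setDDr setDv set0U (setIidPr ME).
apply/andP/eqP => [[NM /and3P[/eqP Nc _ _]]|->]; last by rewrite subxx.
have [/eqP Mc /trivIsetP Mt M0] := and3P Mp.
apply/eqP; rewrite eqEsubset NM; apply/subsetP => a aM.
have /set0Pn[x xa] : a != set0 by apply: contraNneq M0 => <-.
have : x \in cover N by rewrite Nc inE.
case/bigcupP => b bN xb; have [->//|ab] := eqVneq a b.
have /disjointFr/(_ xa) := Mt _ _ aM (subsetP NM _ bN) ab.
by rewrite xb.
Qed.

End Graphs.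

(* Main.v *)
Require Import Defs.
From mathcomp Require Import all_boot.

(** Let S be a global forcing set, M a perfect matching and L = E \ S.  If some
vertex x meets at most one edge of L, then at least deg x - 1 edges of S meet x;
delete all edges at x but its M-edge, remove both ends of that M-edge, and
induct.  To find x, take a perfect matching N with |N /\ S| minimal: a perfect
matching of L \/ N has its trace on S inside that of N, hence equal to it, so N
is the unique perfect matching of L \/ N.  If every vertex had L-degree at least
2, take a longest N-alternating path starting and ending with N-edges.  Each end
has an L-neighbour off N, which lies on the path and closes an odd cycle with
it, since an alternating cycle would contradict uniqueness.  If the two odd
cycles overlapped, the two closing edges and two pieces of the path would form
an alternating cycle; if they are disjoint, shifting N along the path between
them gives a perfect matching of what remains. *)

Set Implicit Arguments.
Unset Strict Implicit.
Unset Printing Implicit Defensive.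

(** * Perfect matchings as partner functions *)

Lemma set2_inj (T : finType) (x y a b : T) :
  [set x; y] = [set a; b] -> (x = a /\ y = b) \/ (x = b /\ y = a).
Proof.
move=> E; have /set2P xab : x \in [set a; b] by rewrite -E set21.
have /set2P yab : y \in [set a; b] by rewrite -E set22.
have /set2P axy : a \in [set x; y] by rewrite E set21.
have /set2P bxy : b \in [set x; y] by rewrite E set22.
by case: xab yab axy bxy => -> [] -> [] ? [] ?; subst; auto.
Qed.

Section Mates.
Variables (T : finType) (e : rel T).
Hypotheses (e_sym : symmetric e) (e_irr : irreflexive e).
Implicit Types (V W : {set T}) (M N : {set {set T}}) (m : T -> T) (c : seq T).

Lemma set2_edges V x y : [set x; y] \in edges V e = [&& x \in V, y \in V & e x y].
Proof.
apply/idP/and3P => [/imset2P[a b aV] | [xV yV exy]]; last first.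
  by apply/imset2P; exists x y; rewrite ?inE ?yV.
rewrite inE => /andP[bV eab] /set2_inj[] [-> ->] //.
by rewrite e_sym.
Qed.

(** A perfect matching of the subgraph induced by [V], encoded as an involution along edges. Values
    of [m] off [V] carry no information. *)
Definition mates V m :=
  {in V, forall x, [/\ m x \in V, m (m x) = x & e x (m x)]}.

Lemma mates_pm V m :
  mates V m -> [set [set x; m x] | x in V] \in perfect_matchings V e.
Proof.
move=> mV; rewrite inE; apply/andP; split.
  apply/subsetP=> _ /imsetP[x xV ->]; have [mxV _ exm] := mV x xV.
  by rewrite set2_edges xV mxV.
apply/and3P; split.
- rewrite eqEsubset; apply/andP; split; apply/subsetP=> x.
    case/bigcupP=> _ /imsetP[y yV ->]; have [myV _ _] := mV y yV.
    by rewrite !inE => /orP[] /eqP->.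
  by move=> xV; apply/bigcupP; exists [set x; m x]; [apply/imsetP; exists x | rewrite set21].
- apply/trivIsetP=> _ _ /imsetP[x xV ->] /imsetP[y yV ->].
  have [_ mmx _] := mV x xV; have [_ mmy _] := mV y yV.
  rewrite -setI_eq0; apply: contraNT => /set0Pn[z /setIP[/set2P zx /set2P zy]].
  apply/eqP; case: zx zy => -> [] E.
  + by rewrite E.
  + by rewrite E mmy setUC.
  + by rewrite -E mmx setUC.
  + by rewrite -mmx E mmy.
- by apply/imsetP=> -[x _ /setP/(_ x)]; rewrite !inE eqxx.
Qed.

Lemma pm_mates V M :
  M \in perfect_matchings V e ->
  exists2 m, mates V m & M = [set [set x; m x] | x in V].
Proof.
rewrite inE => /andP[/subsetP ME Mp].
have [/eqP Mc Mt _] := and3P Mp.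
pose m x := odflt x [pick y | [set x; y] \in M].
have mP x : x \in V -> [set x; m x] \in M.
  move=> xV; rewrite /m; case: pickP => //= none.
  move: xV; rewrite -Mc => /bigcupP[A AM xA].
  have /imset2P[a b _ _ Aab] := ME A AM; subst A.
  case/set2P: xA => ?; subst x; first by rewrite none in AM.
  by rewrite setUC none in AM.
have mE x : x \in V -> [/\ m x \in V, m (m x) = x & e x (m x)].
  move=> xV; have xM := mP x xV; have := ME _ xM.
  rewrite set2_edges => /and3P[_ myV exm]; split=> //.
  have yM := mP _ myV.
  have E : [set x; m x] = [set m x; m (m x)].
    rewrite -(def_pblock Mt xM (set22 _ _)).
    by rewrite -(def_pblock Mt yM (set21 _ _)).
  by case: (set2_inj E) => [] [// E1 _]; rewrite -E1 e_irr in exm.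
exists m => //; apply/setP=> A; apply/idP/imsetP=> [AM|[x xV ->]]; last exact: mP.
have /imset2P[a b aV _ Aab] := ME A AM; exists a => //.
rewrite -(def_pblock Mt AM (x := a)) ?Aab ?set21 //.
by apply: def_pblock; rewrite ?set21 ?mP.
Qed.

(* Replaces the pairs {a, m a}, a in c, by the pairs {m a, next c a}. *)
Definition flip m c x :=
  if x \in c then m (prev c x) else if m x \in c then next c (m x) else m x.

(** Each new pair [{m a, next c a}] lies wholly inside or wholly outside [W], so the flipped
    involution restricts to [W]. Taking [W = V] switches along an alternating cycle; a smaller [W]
    shifts the matching along a path whose two extreme vertices are removed. *)
Lemma mates_flip V W m c :
    mates V m -> W \subset V -> {subset c <= V} -> uniq c ->
    {in c, forall a, m a \notin c} ->
    {in c, forall a, [/\ m a \in W, next c a \in W & e (m a) (next c a)]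
                  \/ (m a \notin W /\ next c a \notin W)} ->
    {in W, forall x, x \notin c -> m x \notin c -> m x \in W} ->
  mates W (flip m c).
Proof.
move=> mV /subsetP WV cV Uc mc cW Wc x xW; have xV := WV x xW.
have [mxV mmx exm] := mV x xV; rewrite {2 3}/flip /flip.
case: ifP => [xc | xNc].
  have pc : prev c x \in c by rewrite mem_prev.
  have [_ mmp _] := mV _ (cV _ pc).
  rewrite (negPf (mc _ pc)) mmp pc next_prev //.
  case: (cW _ pc); rewrite next_prev //; last by case=> _; rewrite xW.
  by case=> ? _; rewrite e_sym.
case: ifP => [mxc | mxNc].
  have nc : next c (m x) \in c by rewrite mem_next.
  rewrite nc prev_next // mmx.
  by case: (cW _ mxc); rewrite mmx //; case; rewrite xW.
by rewrite mxNc mmx xNc exm Wc ?xNc ?mxNc.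
Qed.

End Mates.

(** The three cases are: [b] before [a], same position, [a] before [b]. This decides later whether
    two odd cycles attached to one path overlap. *)
Lemma cat_cons_inj (T : Type) (s1 u1 s2 u2 : seq T) (a b : T) :
    u1 ++ a :: u2 = s1 ++ b :: s2 ->
  [\/ exists v, u1 = s1 ++ b :: v /\ s2 = v ++ a :: u2,
      [/\ a = b, u1 = s1 & u2 = s2]
    | exists v, s1 = u1 ++ a :: v /\ u2 = v ++ b :: s2].
Proof.
elim: u1 s1 => [|x u1 IHu] [|y s1] /= [-> E].
- exact: Or32.
- by apply: Or33; exists s1.
- by apply: Or31; exists u1.
move: E.
case/IHu=> [[v [-> ->]] | [-> -> ->] | [v [-> ->]]].
- by apply: Or31; exists v.
- by apply: Or32.
- by apply: Or33; exists v.
Qed.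

(** * Alternating paths and cycles *)

Section AlternatingPaths.
Variables (T : finType) (e : rel T).
Hypotheses (e_sym : symmetric e) (e_irr : irreflexive e).
Variables (V : {set T}) (m : T -> T).
Hypothesis mV : mates e V m.

(* A sequence a_0, ..., a_k encodes the alternating walk
   a_0, m a_0, a_1, m a_1, ..., a_k, m a_k. *)
Let step a b := e (m a) b && (b != a).

(** The entries stand for distinct matching edges, each listed through one of its ends only; hence
    the walk through them repeats no vertex. *)
Definition spread (s : seq T) :=
  [/\ uniq s, {subset s <= V} & {in s, forall a, m a \notin s}].

Definition alt_path s := sorted step s /\ spread s.

Definition walk (s : seq T) := flatten [seq [:: a; m a] | a <- s].

Lemma size_walk s : size (walk s) = (size s).*2.
Proof. by elim: s => //= a s ->. Qed.

Lemma mateK : {in V, involutive m}.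
Proof. by move=> x /mV[]. Qed.

Lemma mate_in x : x \in V -> m x \in V.
Proof. by move=> /mV[]. Qed.

Lemma mate_edge x : x \in V -> e x (m x).
Proof. by move=> /mV[]. Qed.

Lemma mem_walk s x : {subset s <= V} -> x \in V ->
  (x \in walk s) = (x \in s) || (m x \in s).
Proof.
move=> sV xV; apply/idP/idP.
  case/flattenP=> _ /mapP[a aS ->]; rewrite !inE.
  by case/orP=> /eqP->; rewrite ?aS // mateK ?aS ?orbT ?sV.
case/orP=> H; apply/flattenP.
  by exists [:: x; m x]; rewrite ?inE ?eqxx //; apply/mapP; exists x.
exists [:: m x; x]; rewrite ?inE ?eqxx ?orbT //.
by apply/mapP; exists (m x); rewrite ?mateK.
Qed.

Lemma walk_mate s x : {subset s <= V} -> x \in V ->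
  (m x \in walk s) = (x \in walk s).
Proof. by move=> sV xV; rewrite !mem_walk ?mate_in // mateK // orbC. Qed.

Lemma walk_sub s : {subset s <= V} -> {subset walk s <= V}.
Proof.
move=> sV x /flattenP[_ /mapP[a aS ->]]; rewrite !inE.
by case/orP=> /eqP->; rewrite ?mate_in ?sV.
Qed.

Lemma uniq_walk s : spread s -> uniq (walk s).
Proof.
case; elim: s => //= a s IHs /andP[aNs Us] sV ms.
have aV : a \in V by rewrite sV ?mem_head.
have sV' : {subset s <= V} by move=> x xs; rewrite sV // inE xs orbT.
have mas := ms a (mem_head _ _); rewrite inE negb_or in mas.
case/andP: mas => maNa maNs.
rewrite inE eq_sym (negPf maNa) !mem_walk ?mate_in ?mateK //.
rewrite (negPf aNs) (negPf maNs) /= IHs // => x xs.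
have /ms : x \in a :: s by rewrite inE xs orbT.
by rewrite inE negb_or => /andP[].
Qed.

Lemma path_walk b s : {subset s <= V} -> path step b s ->
  path e (m b) (walk s) /\ last (m b) (walk s) = m (last b s).
Proof.
elim: s b => //= a s IHs b sV /andP[/andP[-> _] pth].
have aV : a \in V by rewrite sV ?mem_head.
rewrite mate_edge //=; apply: IHs => // x xs.
by rewrite sV // inE xs orbT.
Qed.

Lemma spread_sub s s' : subseq s s' -> spread s' -> spread s.
Proof.
move=> ss [Us sV ms]; split; first exact: subseq_uniq ss Us.
  by move=> x /(mem_subseq ss)/sV.
move=> a /(mem_subseq ss)/ms; apply: contra; exact: mem_subseq ss _.
Qed.

(** Backwards, every matching edge is entered through its other end, hence the [map m]. *)
Lemma alt_path_rev s : alt_path s -> alt_path (rev (map m s)).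
Proof.
case=> pth [Us sV ms]; split; last split.
- rewrite rev_sorted sorted_map.
  rewrite (eq_in_sorted (P := mem V) (e' := step)) //; last by apply/allP.
  move=> a b aV bV; rewrite /step /= mateK // e_sym; congr (_ && _).
  by rewrite eq_sym (inj_in_eq (can_in_inj mateK)).
- rewrite rev_uniq map_inj_in_uniq // => a b /sV aV /sV bV.
  exact: (can_in_inj mateK).
- by move=> x; rewrite mem_rev => /mapP[a /sV aV ->]; rewrite mate_in.
move=> x; rewrite !mem_rev => /mapP[a as_ ->]; rewrite mateK ?sV //.
apply: contraL as_ => /mapP[b bs ->]; exact: ms.
Qed.

(** Flipping along the cycle gives the second matching. It differs from [m] at the head [a]: the new
    partner is [m (prev c a)], and [prev c a != a] by the inequality in [step]. *)
Lemma alt_cycle_mates c : c != [::] -> cycle step c -> spread c ->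
  exists2 m', mates e V m' & exists2 x, x \in V & m' x != m x.
Proof.
case: c => // a c _ cyc [Uc cV mc]; exists (flip m (a :: c)).
  apply: (mates_flip e_sym mV) => // [b bc|x xV _ _]; last exact: mate_in.
  by left; rewrite mate_in ?cV ?mem_next //; case/andP: (next_cycle cyc bc).
exists a; rewrite ?cV ?mem_head // /flip mem_head.
have pc : prev (a :: c) a \in a :: c by rewrite mem_prev mem_head.
have /andP[_] := prev_cycle cyc (mem_head a c).
apply: contra => /eqP E.
by rewrite -[prev _ _]mateK ?cV // E mateK ?cV ?mem_head.
Qed.

(** The path ends in the vertex [m z], and [w] is a neighbour of it off the matching. Either [w] is
    new and extends the path, or [w] is the first end of a matching edge of the path and closes an
    alternating cycle, or it is a second end [m b] and closes an odd one. *)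
Lemma alt_path_end s z w :
    alt_path (rcons s z) -> w \in V -> e (m z) w -> w != z ->
  [\/ alt_path (rcons (rcons s z) w),
      exists c, [/\ c != [::], cycle step c & spread c]
    | exists s1 b s2, [/\ rcons s z = s1 ++ b :: s2, s2 != [::] & w = m b]].
Proof.
move=> [pth spr] wV ezw wz; have [Ut tV mt] := spr.
have zV : z \in V by rewrite tV // mem_rcons mem_head.
have split x : x \in rcons s z -> exists s1 s2, rcons s z = s1 ++ x :: s2.
  by case/splitPr=> s1 s2; exists s1, s2.
have [/split[s1 [s2 Et]] | wNt] := boolP (w \in rcons s z).
  apply: Or32; rewrite Et in pth spr.
  exists (w :: s2); split=> //; last first.
    exact: spread_sub (suffix_subseq _ _) spr.
  have lz : last w s2 = z.
    by have := congr1 (last z) Et; rewrite last_rcons last_cat.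
  rewrite /= rcons_path lz /step ezw wz /= andbT.
  by have [_] := cat_sorted2 pth.
have [/split[s1 [s2 Et]] | mwNt] := boolP (m w \in rcons s z).
  apply: Or33.
  exists s1, (m w), s2; rewrite mateK //; split=> //.
  (* If [s2] were empty, [w] would be [m z] itself and the edge a loop. *)
  apply: contraTneq ezw => E; move: Et; rewrite E cats1 => /rcons_inj[_ ->].
  by rewrite mateK // e_irr.
apply: Or31; split; last split.
- move: pth; case: s {split Ut tV mt spr wNt mwNt} => [|a s] /=.
    by rewrite /step ezw wz.
  by rewrite [in X in _ -> X]rcons_path last_rcons => ->; rewrite /step ezw wz.
- by rewrite rcons_uniq wNt.
- by move=> x; rewrite mem_rcons inE => /orP[/eqP->//|/tV].
move=> x; rewrite mem_rcons inE => /orP[/eqP->|xt].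
  rewrite mem_rcons inE negb_or mwNt andbT.
  by apply: contraTneq (mate_edge wV) => ->; rewrite e_irr.
rewrite mem_rcons inE negb_or mt // andbT.
by apply: contra mwNt => /eqP <-; rewrite mateK ?tV.
Qed.

(** * Odd cycles at the two ends of a path *)

Lemma spread_cat s1 s2 : spread (s1 ++ s2) ->
  {in s1 & s2, forall x y, x != y /\ m x != y}.
Proof.
case=> Us _ ms x y xs ys; split; apply/eqP => E; subst y.
  by move: Us; rewrite cat_uniq => /and3P[_ /hasPn/(_ _ ys)]; rewrite /= xs.
by have := ms x; rewrite !mem_cat xs ys orbT => /(_ isT).
Qed.

(** The single vertex [m b] followed by whole matching edges makes the length odd; [s != [::]] makes
    it at least 3. *)
Lemma back_ear b s : path step b s -> spread (b :: s) -> s != [::] ->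
  e (m (last b s)) (m b) -> is_odd_cycle e (m b :: walk s).
Proof.
move=> pth spr s0 ebb; have [_ sV ms] := spr.
have bV : b \in V by rewrite sV ?mem_head.
have sV' : {subset s <= V} by move=> x xs; rewrite sV // inE xs orbT.
have [ep lp] := path_walk sV' pth.
split; last by rewrite /= size_walk odd_double.
- rewrite /ucycle /= rcons_path ep lp ebb /=.
  by have /= /andP[] := uniq_walk spr.
- by rewrite /= size_walk; case: (s) s0.
Qed.

(** Mirror image of [back_ear]: the first vertex [h] of the path is joined to [a], and [m a] stays
    off the cycle. *)
Lemma front_ear h s a : path step h (rcons s a) -> spread (h :: rcons s a) ->
  e h a -> is_odd_cycle e (a :: walk (h :: s)).
Proof.
move=> pth spr eha; have [_ sV ms] := spr.
have hV : h \in V by rewrite sV ?mem_head.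
have aV : a \in V by rewrite sV // inE mem_rcons mem_head orbT.
have sV' : {subset s <= V}.
  by move=> x xs; rewrite sV // inE mem_rcons inE xs !orbT.
move: pth; rewrite rcons_path => /andP[pth /andP[ela _]].
have [ep lp] := path_walk sV' pth.
have U : uniq (a :: walk (h :: s)).
  (* Rotating the walk brings [a, m a] to the front; dropping [m a] leaves the cycle. *)
  have := uniq_walk spr; rewrite -cats1 -cat_cons /walk map_cat flatten_cat uniq_catC.
  apply: subseq_uniq; rewrite /= eqxx.
  exact: (suffix_subseq [:: m a] (walk (h :: s))).
split; last by rewrite /= size_walk /= odd_double.
- by rewrite /ucycle U andbT /= e_sym eha mate_edge // rcons_path ep lp ela.
- by rewrite /= size_walk.
Qed.

(** The configuration forbidden in the class, stated for the subgraph induced by [V] because the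
    induction deletes vertices. *)
Definition odd_pair :=
  exists c c', [/\ is_odd_cycle e c, is_odd_cycle e c', [disjoint c & c'],
    {subset c ++ c' <= V}
    & has_perfect_matching (V :\: [set x in c] :\: [set x in c']) e].

Definition second_matching :=
  exists2 m', mates e V m' & exists2 x, x \in V & m' x != m x.

(* The remaining vertices are matched by flipping m along a :: c: only a and
   m b lose their partners, and they lie on the two odd cycles. *)
Lemma disjoint_ears h u a c s :
    let b := last a c in
    path step h (u ++ a :: c ++ s) -> spread ((h :: u) ++ (a :: c) ++ s) ->
    e h a -> s != [::] -> e (m (last b s)) (m b) -> odd_pair.
Proof.
move=> b pth spr eha s0 elb.
have [_ sV ms] := spr.
have cV : {subset a :: c <= V} by move=> x xc; rewrite sV // !mem_cat xc !orbT.
have huV : {subset h :: u <= V} by move=> x xc; rewrite sV // !mem_cat xc.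
have ssV : {subset s <= V} by move=> x xc; rewrite sV // !mem_cat xc !orbT.
have aV : a \in V by rewrite cV ?mem_head.
have ac : a \in a :: c by rewrite mem_head.
have bc : b \in a :: c by rewrite mem_last.
have bV : b \in V by rewrite cV.
have [Uc _ mc] : spread (a :: c).
  apply: spread_sub spr.
  exact: subseq_trans (prefix_subseq _ _) (suffix_subseq _ _).
have inw x t : {subset t <= V} -> x \in t -> x \in walk t.
  by move=> tV xt; rewrite mem_walk ?xt ?tV.
have [AB AD BD] : [/\ {in walk (a :: c), forall x, x \notin walk (h :: u)},
    {in walk s, forall x, x \notin walk (h :: u)}
  & {in walk s, forall x, x \notin walk (a :: c)}].
  have := uniq_walk spr; rewrite /walk !map_cat !flatten_cat -!/(walk _).
  rewrite cat_uniq => /and3P[_ /hasPn AN]; rewrite cat_uniq => /and3P[_ /hasPn BD _].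
  by split=> // x xw; apply: AN; rewrite mem_cat xw ?orbT.
set C' := a :: walk (h :: u); set C := m b :: walk s.
have memC x : (x \in C) = (x == m b) || (x \in walk s) by [].
have memC' x : (x \in C') = (x == a) || (x \in walk (h :: u)) by [].
have C'V : {subset C' <= V}.
  by move=> x; rewrite memC' => /orP[/eqP->//|]; apply: walk_sub.
have CV : {subset C <= V}.
  by move=> x; rewrite memC => /orP[/eqP->|]; [rewrite mate_in | apply: walk_sub].
move: (pth); rewrite cat_path /= => /and3P[pu /andP[ela aN]].
rewrite cat_path => /andP[pc ps].
exists C, C'; split.
- apply: back_ear => //.
  by apply: spread_sub spr; rewrite (lastI a) cat_rcons catA; apply: suffix_subseq.
- apply: front_ear => //; first by rewrite rcons_path pu /step ela aN.
  apply: spread_sub spr; rewrite -rcons_cons -cats1; apply: cat_subseq => //.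
  exact: prefix_subseq [:: a] (c ++ s).
- apply/pred0P=> x /=; apply/negP=> /andP[xC].
  have xV := CV x xC; move: xC; rewrite memC memC'.
  case/orP=> [/eqP-> | xs] /orP[/eqP E | xu].
  + by move: (mc b bc); rewrite E mem_head.
  + by have := AB (m b); rewrite xu walk_mate ?inw // => /(_ isT).
  + by have := BD x xs; rewrite E inw.
  + by have := AD x xs; rewrite xu.
- by move=> x; rewrite mem_cat => /orP[/CV|/C'V].
set W := _ :\: _ :\: _.
have inW x : x \in W = [&& x \in V, x \notin C & x \notin C'].
  rewrite 2!in_setD ![_ \in [set _ in _]]in_set.
  by rewrite andbC -andbA andbCA andbC -andbA.
(* [a :: c] is only a path. [st] also admits the closing pair from [b] to [a], so that the cycle
   lemmas give the values of [next]. *)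
pose st x y := if y == a then x == b else step x y.
have cyc : cycle st (a :: c).
  have aux z q : a \notin q -> path step z q -> path st z q.
    elim: q z => //= y q IHq z; rewrite inE negb_or eq_sym.
    case/andP=> ay aNq /andP[szy pq].
    by rewrite {1}/st (negPf ay) szy IHq.
  case/andP: Uc => aNc _.
  by rewrite /= rcons_path aux // /st eqxx (eqxx b).
have next_b : next (a :: c) b = a.
  have pa : prev (a :: c) a \in a :: c by rewrite mem_prev.
  have := next_cycle cyc pa; rewrite next_prev // /st eqxx => /eqP <-.
  by rewrite next_prev.
(* On this middle piece, [W] misses exactly [a] and [m b], the vertices used by the odd cycles. *)
have BW x : x \in a :: c -> [/\ m x \in W = (x != b) & x \in W = (x != a)].
  move=> xc; have xV := cV x xc; split; rewrite inW ?mate_in ?xV //.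
    rewrite memC memC' 2!negb_or (inj_in_eq (can_in_inj mateK)) //.
    have -> : m x != a by apply: contraNneq (mc x xc) => ->.
    have -> : m x \notin walk s by apply: contraL (inw _ _ cV xc) => /BD; rewrite walk_mate.

    have -> : m x \notin walk (h :: u) by rewrite AB // walk_mate ?inw.
    by rewrite !andbT.
  rewrite memC memC' 2!negb_or.
  have -> : x \notin walk (h :: u) by rewrite AB ?inw.
  have -> : x != m b by apply: contraNneq (mc b bc) => <-.
  have -> : x \notin walk s by apply: contraL (inw _ _ cV xc) => /BD.
  by rewrite !andbT.
exists [set [set x; flip m (a :: c) x] | x in W]; apply: mates_pm => //.
apply: (mates_flip e_sym mV) => //.
- by apply/subsetP=> x; rewrite inW => /andP[].
- move=> x xc; have nc : next (a :: c) x \in a :: c by rewrite mem_next.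
  have [-> _] := BW x xc; have [_ ->] := BW _ nc.
  (* The closing pair [{m b, a}] falls outside [W]; every other new pair is an edge inside [W]. *)
  have := next_cycle cyc xc; rewrite /st; case: eqP => [_ /eqP-> | nx].
    by right; rewrite eqxx.
  by case/andP=> enx _; left; split=> //; apply/eqP=> E; rewrite E next_b in nx.
move=> x; rewrite !inW !memC !memC' 4!negb_or => /and3P[xV /andP[_ xs] /andP[_ xu]].
move=> xc mxc; rewrite mate_in // (inj_in_eq (can_in_inj mateK)) // !walk_mate // xs xu.
have -> : m x != a by apply: contraNneq mxc => ->.
by rewrite !andbT; apply: contraNneq xc => ->.
Qed.

(** If [b] comes before [a], the odd cycles overlap and an alternating cycle exists; otherwise they
    are disjoint and [disjoint_ears] applies. *)
Lemma two_ears h u1 a u2 s1 b s2 :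
    h :: u1 ++ a :: u2 = s1 ++ b :: s2 -> alt_path (s1 ++ b :: s2) ->
    e h a -> s2 != [::] -> e (m (last b s2)) (m b) ->
  second_matching \/ odd_pair.
Proof.
move=> E; rewrite -E => -[pth spr] eha s20 elb.
case: (@cat_cons_inj _ s1 (h :: u1) s2 u2 a b E) => {E}.
- case=> v [Eh Es2]; left.
  have Es : h :: u1 ++ a :: u2 = rcons s1 b ++ v ++ a :: u2.
    by rewrite -cat_cons Eh cat_rcons -catA.
  rewrite Es in pth spr; have [Us sV ms] := spr.
  have sub : subseq (rcons s1 b ++ a :: u2) (rcons s1 b ++ v ++ a :: u2).
    by rewrite cat_subseq // suffix_subseq.
  have spr' := spread_sub sub spr; have [_ sV' _] := spr'.
  have aV : a \in V by rewrite sV' // mem_cat mem_head orbT.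
  have bV : b \in V by rewrite sV' // mem_cat mem_rcons mem_head.
  have alt_a : alt_path (rev (map m (a :: u2))).
    apply: alt_path_rev; split.
      by have [_ pth'] := cat_sorted2 pth; have [_] := cat_sorted2 pth'.
    by apply: spread_sub spr'; apply: suffix_subseq.
  (* The alternating cycle runs from h to b, jumps to the end of the path and
     runs back to a, hence the reversed second piece. *)
  have [pA _] := cat_sorted2 pth.
  have [Us' _ ms'] := spr'; have AU := spread_cat spr'.
  have [sD [UD DV mD]] := alt_a.
  have memD x : x \in V -> (x \in rev (map m (a :: u2))) = (m x \in a :: u2).
    move=> xV; rewrite mem_rev; apply/mapP/idP => [[y yu ->] | mxu].
      by rewrite mateK // sV' // mem_cat yu orbT.
    by exists (m x); rewrite ?mateK.
  have [A EA] : exists A, rcons s1 b = h :: A.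
    by case: (s1) Eh => [|x s'] [<- _]; [exists [::] | exists (rcons s' b)].
  have lA : last h A = b by have := last_rcons h s1 b; rewrite EA.
  apply: (@alt_cycle_mates (rcons s1 b ++ rev (map m (a :: u2)))).
  + by rewrite EA.
  + rewrite EA cat_cons /= rcons_path cat_path lA last_cat.
    have -> : path step h A by rewrite EA in pA.
    have -> : path step b (rev (map m (a :: u2))).
      move: sD; rewrite lastI map_rcons rev_rcons /= => ->; rewrite andbT.
      rewrite Es2 last_cat /= in elb; rewrite /step e_sym elb /=.
      have lu : last a u2 \in a :: u2 by apply: mem_last.
      have bA : b \in rcons s1 b by rewrite mem_rcons mem_head.
      have [_] := AU b _ bA lu; apply: contraNneq => <-.
      by rewrite mateK // sV' // mem_cat lu orbT.
    rewrite rev_cons last_rcons /step mateK // e_sym eha /=.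
    have hA : h \in rcons s1 b by rewrite EA mem_head.
    have [_] := AU h a hA (mem_head _ _); apply: contraNneq => ->.
    by rewrite mateK.
  split.
  + rewrite cat_uniq UD andbT; move: Us'; rewrite cat_uniq => /and3P[-> _ _] /=.
    apply/hasPn => x xD; apply/negP => /= xA; move: xD.
    rewrite memD ?sV' ?mem_cat ?xA // => mxu.
    by have [_ /eqP] := AU x _ xA mxu.
  + by move=> x; rewrite mem_cat => /orP[xA|/DV//]; apply: sV'; rewrite mem_cat xA.
  move=> x; rewrite !mem_cat negb_or => /orP[xA | xD].
    have xV : x \in V by rewrite sV' // mem_cat xA.
    have := ms' x; rewrite mem_cat xA mem_cat negb_or => /(_ isT)/andP[-> _] /=.
    rewrite memD ?mate_in // mateK //; apply/negP => xu.
    by have [/eqP] := AU x x xA xu.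
  rewrite mD // andbT; apply/negP => mxA; have xV := DV x xD.
  rewrite memD // in xD.
  by have [/eqP] := AU _ _ mxA xD.
(* The middle piece is the single matching edge [{a, m a}], with one end on each odd cycle. *)
- case=> Eab Es1 Eu; subst b s1 u2; right.
  exact: (@disjoint_ears h u1 a [::] s2).
case=> v [Es1 Eu]; subst s1 u2; right.
have Ec t : t ++ a :: v ++ b :: s2 = t ++ a :: rcons v b ++ s2 by rewrite cat_rcons.
apply: (@disjoint_ears h u1 a (rcons v b) s2) => //.
- by rewrite -Ec.
- by rewrite cat_cons -Ec.
by rewrite last_rcons.
Qed.

(** Starting from one matching edge, the path is extended until both ends have their off-matching
    neighbours on it. The induction on [#|T| - size s] replaces the choice of a longest path. *)
Lemma pendant_or_odd_pair :
    V != set0 ->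
    {in V, forall x, exists y, [/\ y \in V, e x y & y != m x]} ->
  second_matching \/ odd_pair.
Proof.
case/set0Pn=> x xV deg.
have: alt_path [:: x].
  split=> //; split=> // y; rewrite inE => /eqP-> //.
  by rewrite inE; apply: contraTneq (mate_edge xV) => ->; rewrite e_irr.
move: (erefl : [:: x] != [::]); move: [:: x] => s.
have [n] := ubnP (#|T| - size s).
elim: n s => // n IHn s lt_n s0 alt_s.
have ext s' w : alt_path (rcons s' w) -> size s' = size s ->
    second_matching \/ odd_pair.
  move=> alt_sw sz; apply: (IHn _ _ _ alt_sw); last by case: (s').
  have [_ [/card_uniqP U _ _]] := alt_sw.
  have := max_card (mem (rcons s' w)); rewrite U size_rcons sz => lt_s.
  by rewrite -ltnS; apply: leq_trans lt_n; rewrite ltnS ltn_sub2l.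
have cyc c : [/\ c != [::], cycle step c & spread c] -> second_matching.
  by case=> c0 cc spr; exact: alt_cycle_mates cc spr.
case: s s0 lt_n alt_s ext => // h s _ lt_n alt_s ext.
have [_ [_ sV _]] := alt_s.
have hs := mem_head h s; have ls := mem_last h s.
have [w [wV ew wN]] := deg _ (mate_in (sV _ ls)).
rewrite mateK ?sV // in wN.
have := alt_path_end (s := belast h s) (z := last h s) (w := w).
rewrite -lastI.
case/(_ alt_s wV ew wN) => [/ext|[c /cyc]|[s1 [b [s2 [Es s20 Ew]]]]]; try by auto.
(* The front end [h] is treated as the last vertex of the reversed path, whose last entry is
   [m h]. *)
have alt_r := alt_path_rev alt_s.
have [y [yV ey yN]] := deg h (sV _ hs).
have := alt_path_end (s := rev (map m s)) (z := m h) (w := y).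
rewrite -rev_cons -map_cons (mateK (sV _ hs)).
case/(_ alt_r yV ey yN) => [/ext|[c /cyc]|[t1 [d [t2 [Et t20 Ey]]]]].
- by apply; rewrite size_rev size_map.
- by left.
(* Undoing the reversal turns the second end [m d] into the listed end [y], as [two_ears]
   requires. *)
have {}Et : h :: s = rev (map m t2) ++ y :: rev (map m t1).
  have := congr1 (fun p => rev (map m p)) Et.
  rewrite map_rev revK -map_comp map_cat rev_cat rev_cons -Ey cat_rcons => <-.
  rewrite -[LHS]map_id; apply/eq_in_map => z zs.
  by rewrite /= mateK ?sV.
have [u Eu] : exists u, rev (map m t2) = h :: u.
  case E: (rev _) Et => [|h' u] /=; last by case=> -> _; exists u.
  by move: t20; rewrite -size_eq0 -(size_map m) -size_rev E.
apply: (@two_ears h u y (rev (map m t1)) s1 b s2) => //.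
- by rewrite -cat_cons -Eu -Et.
- by rewrite -Es.
- by have := congr1 (last h) Es; rewrite last_cat /= => <-; rewrite -Ew.
Qed.

End AlternatingPaths.

(** * From forcing sets to anti-forcing sets *)

Section Forcing.
Variables (T : finType) (e : rel T).
Hypotheses (e_sym : symmetric e) (e_irr : irreflexive e).
Implicit Types (V W : {set T}) (S F M N : {set {set T}}).

(** Global forcing relative to the subgraph induced by [V], for the induction on [V]. *)
Definition forcing V S :=
  {in perfect_matchings V e &, forall M N, M :&: S = N :&: S -> M = N}.

Definition star V x : {set {set T}} := [set A in edges V e | x \in A].

Lemma del_edges_sym S : symmetric (del_edges e S).
Proof. by move=> x y; rewrite /del_edges /= e_sym setUC. Qed.

Lemma starP V x A : A \in star V x -> exists y, [/\ y \in V, e x y & A = [set x; y]].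
Proof.
rewrite inE => /andP[/imset2P[a b aV]]; rewrite inE => /andP[bV eab] -> /set2P[] ->.
  by exists b.
by exists a; rewrite e_sym setUC.
Qed.

Lemma pm_del_edges V S N :
  (N \in perfect_matchings V (del_edges e S))
  = (N \in perfect_matchings V e) && [disjoint N & S].
Proof.
have -> : N \in perfect_matchings V (del_edges e S)
    = (N \subset edges V e :\: S) && partition N V.
  rewrite inE; congr (_ && _); congr (_ \subset pred_of_set _).
  apply/setP=> A; rewrite inE; apply/idP/andP.
    case/imset2P=> x y xV; rewrite inE => /and3P[yV exy xyS] ->.
    by rewrite xyS set2_edges // xV yV exy.
  case=> AS /imset2P[x y xV]; rewrite inE => /andP[yV exy] EA.
  rewrite {}EA in AS *; apply/imset2P; exists x y => //.
  by rewrite inE yV /del_edges /= exy AS.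
by rewrite subsetD inE andbAC.
Qed.

Lemma edges_mono V W A : A \in edges V e -> A \subset W -> A \in edges W e.
Proof.
case/imset2P=> x y _; rewrite inE => /andP[_ exy] -> /subsetP sub.
by rewrite set2_edges // exy !sub ?set21 ?set22.
Qed.

Lemma pm_setU1 V N a :
    a \in edges V e -> N \in perfect_matchings (V :\: a) e ->
  a |: N \in perfect_matchings V e.
Proof.
move=> aE; rewrite !inE => /andP[NE NP].
have aV : a \subset V.
  case/imset2P: aE => x y xV; rewrite inE => /andP[yV _] ->.
  by apply/subsetP=> z /set2P[] ->.
apply/andP; split.
  rewrite subUset sub1set aE; apply/subsetP=> A /(subsetP NE) AE.
  apply: (edges_mono AE); apply/subsetP=> z.
  case/imset2P: AE => x y /setDP[xV _]; rewrite in_set => /andP[/setDP[yV _] _] ->.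
  by case/set2P=> ->.
have -> : V = a :|: (V :\: a) by rewrite -{1}(setID V a) (setIidPr aV).
apply: partitionU1 => //; last by rewrite disjoint_sym disjoints_subset setDE subsetIr.
case/imset2P: aE => x y _ _ ->; apply/set0Pn; exists x; exact: set21.
Qed.

Lemma pm_setD1 V N a :
    N \in perfect_matchings V e -> a \in N ->
  N :\ a \in perfect_matchings (V :\: a) e.
Proof.
rewrite !inE => /andP[NE NP] aN; have P := partitionD1 NP aN; rewrite P andbT.
apply/subsetP=> A AN; apply: (edges_mono (V := V)); last exact: partitionS P AN.
by apply: (subsetP NE); case/setD1P: AN.
Qed.

Lemma odd_pair_del_edges V S : odd_pair (del_edges e S) V -> odd_pair e V.
Proof.
have sub c : is_odd_cycle (del_edges e S) c -> is_odd_cycle e c.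
  case=> /andP[cyc Uc] sz oc; split=> //; rewrite /ucycle Uc andbT.
  by apply: sub_cycle cyc => x y /andP[].
case=> c [c' [oc oc' dis cV [N]]]; rewrite pm_del_edges => /andP[NW _].
by exists c, c'; split; auto; exists N.
Qed.

(** Otherwise [pendant_or_odd_pair] applies to the graph of all edges outside [S] together with a
    perfect matching [M] of least trace on [S], and both of its outcomes are impossible. *)
Lemma small_star V S :
    V != set0 -> has_perfect_matching V e -> ~ odd_pair e V -> forcing V S ->
  exists2 x, x \in V & #|star V x :\: S| <= 1.
Proof.
move=> V0 [M0 M0P] noOdd forceS.
case: (arg_minnP (fun M => #|M :&: S|) M0P) => M MP' Mmin.
have {MP'}MP : M \in perfect_matchings V e := MP'.
have [/exists_inP//|] := boolP [exists x in V, #|star V x :\: S| <= 1].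
rewrite negb_exists_in => /forall_inP big_star; exfalso.
pose J := del_edges e (S :\: M).
have J_sym : symmetric J by apply: del_edges_sym.
have J_irr : irreflexive J by move=> x; rewrite /J /del_edges /= e_irr.
have MJ : M \in perfect_matchings V J.
  by rewrite pm_del_edges MP disjoint_sym disjoints_subset setDE subsetIr.
have [m mV EM] := pm_mates J_sym J_irr MJ.
case: (pendant_or_odd_pair J_sym J_irr mV V0).
(* Of two edges at [x] outside [S], at least one is not the matching edge, and it survives in
   [J]. *)
- move=> x xV; have := big_star x xV; rewrite -ltnNge => /card_gt1P[A [B [AD BD AB]]].
  have [C CD CN] : exists2 C, C \in star V x :\: S & C != [set x; m x].
    have [EA|] := eqVneq A [set x; m x]; last by exists A.
    by exists B => //; rewrite -EA eq_sym.
  move: CD; rewrite inE => /andP[CS /starP[y [yV exy EC]]]; subst C.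
  exists y; split=> //; last by apply: contraNneq CN => ->.
  by rewrite /J /del_edges /= exy inE (negPf CS) andbF.
- case=> m' m'V [x xV /eqP[]].
  have := mates_pm J_sym m'V; set N := [set _ | _ in V] => NJ.
  move: (NJ); rewrite pm_del_edges => /andP[NP NS].
  (* A matching [N] of [J] meets [S] only within [M]; minimality of the trace of [M] then forces
     equal traces, so [N = M]. *)
  have sub : N :&: S \subset M :&: S.
    apply/subsetP=> A /setIP[AN AS]; rewrite inE AS andbT.
    by have := disjointFr NS AN; rewrite inE AS andbT => /negbFE.
  have NM : N = M by apply: forceS => //; apply/eqP; rewrite eqEcard sub Mmin.
  have : [set x; m' x] \in M by rewrite -NM; apply/imsetP; exists x.
  rewrite EM => /imsetP[z zV /set2_inj[][-> ->] //].
  by have [_ ->] := mV z zV.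
by move/odd_pair_del_edges.
Qed.

(** Induction on [#|V|]: the vertex [x] from [small_star] is removed with its partner in [M], and
    the edges at [x] other than its [M]-edge [a] join the set [F] obtained for the rest. *)
Lemma anti_forcing_of_forcing V M S :
    M \in perfect_matchings V e -> ~ odd_pair e V -> forcing V S ->
  exists F, [/\ F \subset edges V e :\: M, #|F| <= #|S|
    & {in perfect_matchings V e, forall N, [disjoint N & F] -> N = M}].
Proof.
have [n] := ubnP #|V|; elim: n V M S => // n IHn V M S ltVn MP noOdd forceS.
have [V0|V0] := eqVneq V set0.
  exists set0; rewrite sub0set cards0; split=> // N NP _.
  move: MP NP; rewrite V0 !inE => /andP[_ +] /andP[_].
  by rewrite !partition_set0 => /eqP-> /eqP->.
have [x xV Dx] := small_star V0 (ex_intro _ M MP) noOdd forceS.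
have [m mV EM] := pm_mates e_sym e_irr MP.
have [mxV mmx exm] := mV x xV.
set a := [set x; m x]; have aM : a \in M by rewrite EM; apply/imsetP; exists x.
have ME : M \subset edges V e by move: MP; rewrite inE => /andP[].
have aD : a \in star V x by rewrite inE set21 (subsetP ME).
set V' := V :\: a.
have aE := subsetP ME a aM.
have sub_edges A : A \in edges V' e -> A \in edges V e /\ x \notin A.
  case/imset2P=> y z; rewrite !inE !negb_or => /andP[/andP[yx _] yV].
  case/andP=> /andP[/andP[zx _] zV] eyz ->.
  by rewrite set2_edges // yV zV !inE negb_or ![x == _]eq_sym yx zx.
have at_x N A : N \in perfect_matchings V e -> A \in N -> a \in N -> x \in A -> A = a.
  rewrite inE => /andP[_ /and3P[_ tN _]] AN aN xA.
  by rewrite -(def_pblock tN AN xA) (def_pblock tN aN (set21 _ _)).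
have NE' N : N \in perfect_matchings V' e -> N \subset edges V' e /\ a \notin N.
  rewrite inE => /andP[NE _]; split=> //.
  by apply/negP => /(subsetP NE)/sub_edges[_]; rewrite set21.
have ltV' : #|V'| < n.
  rewrite -ltnS; apply: leq_trans ltVn; rewrite ltnS; apply: proper_card.
  apply/properP; split; first exact: subsetDl.
  by exists x => //; rewrite inE set21.
have noOdd' : ~ odd_pair e V'.
  (* Odd cycles inside [V'] avoid both ends of [a], so adding [a] to the matching of the rest gives
     a forbidden pair in [V]. *)
  case=> c [c' [oc oc' dis cV [N NW]]]; apply: noOdd; exists c, c'; split=> //.
    by move=> z /cV /setDP[].
  exists (a |: N); apply: pm_setU1.
    apply: (edges_mono aE); apply/subsetP=> z za; rewrite !inE.
    have zc : z \notin c ++ c' by apply/negP=> /cV; rewrite inE za.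
    move: zc; rewrite mem_cat negb_or => /andP[-> ->].
    by case/set2P: za => ->.
  by move: NW; rewrite /V' !setDDl [a :|: _]setUC setUA.
have forceS' : forcing V' (S :&: edges V' e).
  (* Adding [a] to both matchings keeps their traces on [S] equal, so the forcing property on [V]
     applies. *)
  move=> N1 N2 N1P N2P; have [E1 aN1] := NE' _ N1P; have [E2 aN2] := NE' _ N2P.
  rewrite !setIA !(setIidPl (subset_trans (subsetIl _ _) _)) // => trace.
  have : a |: N1 = a |: N2.
    by apply: forceS; rewrite ?pm_setU1 // !setIUl trace.
  by move/(congr1 (fun N => N :\ a)); rewrite !setU1K.
have [F [FE leF FM]] := IHn V' (M :\ a) _ ltV' (pm_setD1 MP aM) noOdd' forceS'.
exists (F :|: star V x :\ a); split.
- rewrite subUset; apply/andP; split; apply/subsetP=> A.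
    move/(subsetP FE)/setDP=> [AE' AM]; have [AE xA] := sub_edges A AE'.
    rewrite inE AE andbT; apply: contra AM => AM; rewrite !inE AM andbT.
    by apply: contraNneq xA => ->; rewrite set21.
  rewrite !inE => /and3P[Aa AE xA]; rewrite AE andbT.
  by apply: contra Aa => AM; apply/eqP; apply: at_x MP AM aM xA.
- apply: leq_trans (leq_card_setU _ _) _.
  (* [S] splits into edges at [x] and the others. At most one edge at [x] lies outside [S], which is
     compensated by leaving out [a]; the other part of [S] contains the forcing set used on [V']. *)
  rewrite -(cardsID (star V x) S) addnC; apply: leq_add.
    have := cardsID S (star V x); rewrite (cardsD1 a (star V x)) aD setIC => Dcard.
    by rewrite -(leq_add2l 1) -Dcard addnC leq_add2r.
  apply: leq_trans leF _; apply: subset_leq_card; apply/subsetP=> A /setIP[AS AE'].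
  by have [AE xA] := sub_edges A AE'; rewrite !inE AS (negPf xA) andbF.
move=> N NP; rewrite -setI_eq0 setIUr setU_eq0 !setI_eq0 => /andP[NF Nx].
(* [N] must cover [x], and [a] is the only edge at [x] left to it. *)
have aN : a \in N.
  have : x \in cover N by move: NP; rewrite inE => /andP[_ /and3P[/eqP-> _ _]].
  case/bigcupP=> A AN xA; have AE : A \in edges V e.
    by move: NP; rewrite inE => /andP[/subsetP NE _]; apply: NE.
  have [<-//|Aa] := eqVneq A a.
  by move/disjointFr: Nx => /(_ A AN); rewrite !inE Aa AE xA.
rewrite -(setD1K aN) -(setD1K aM); congr (_ |: _); apply: FM; first exact: pm_setD1.
by apply: disjointWl NF; apply: subD1set.
Qed.

End Forcing.

(** * The inequality for the whole graph *)

Theorem theorem4p6 (T : finType) (e : rel T)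
  (e_sym : symmetric e) (e_irr : irreflexive e) (eG : in_classG e) :
  Af e <= gf e.
Proof.
have noOdd : ~ odd_pair e [set: T].
  case: eG => _ noC [c [c' [oc oc' dis _ pm]]]; apply: noC.
  by exists c, c'; split=> //; rewrite -setTD.
rewrite /gf; case: (arg_minnP _ (global_forcing_default e)) => S.
case/andP=> _ /forall_inP forceS _.
have {}forceS : forcing e setT S.
  move=> M N MP NP trace; apply/eqP.
  by move: (forceS M MP) => /forall_inP/(_ N NP)/implyP; apply; apply/eqP.
apply/bigmax_leqP => M MP.
have [F [FE leF FM]] := anti_forcing_of_forcing e_sym e_irr MP noOdd forceS.
(* [F] is itself admissible in the minimum defining [af e M], so that minimum is at most [#|F|]. *)
apply: leq_trans leF; rewrite /af.
case: (arg_minnP _ (anti_forcing_default MP)) => S' _; apply.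
rewrite /anti_forcing FE; apply/cards1P; exists M; apply/setP=> N.
rewrite pm_del_edges // inE; apply/andP/eqP => [[NP /FM]|->]; first exact.
split=> //; rewrite disjoint_sym disjoints_subset.
by apply: subset_trans FE _; rewrite setDE subsetIr.
Qed.
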